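(* Every graph $G$ with no isolated vertices has an induced forest with at least $\sum_{v\in V(G)} \frac{2}{d_G(v)+1}$ vertices, every connected component of which is a caterpillar.
   Context: All graphs are finite, simple, and undirected; $d_G(v)$ denotes the degree of vertex $v$ in $G$. A caterpillar is any tree that can be obtained from a path $P$ with at least one vertex by adding a (possibly empty) set of new vertices and making each new vertex adjacent to a vertex of $P$ (exactly one, since the result is a tree). In particular, a graph consisting of a single vertex is a caterpillar. An induced forest of $G$ is an induced subgraph of $G$ that is a forest. *)

(* Defs.v *)
From mathcomp Require Import all_boot all_order all_algebra.

Set Implicit Arguments.
Unset Strict Implicit.
Unset Printing Implicit Defensive.

(* A finite simple graph is a symmetric irreflexive relation [e] on a finType
   [T].  The predicates below taking a vertex set [A] are about the induced
   subgraph G[A]. *)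

Definition degree (T : finType) (e : rel T) (v : T) : nat :=
  #|[set u | e v u]|.

Definition induced (T : finType) (e : rel T) (A : {set T}) : rel T :=
  [rel u v | [&& u \in A, v \in A & e u v]].

(* [ucycle] also accepts the sequences [::] and [:: u; v] with [e u v]; only
   the simple closed sequences with at least three vertices are cycles of a
   simple graph. *)
Definition is_forest (T : finType) (e : rel T) (A : {set T}) : Prop :=
  forall c : seq T, 2 < size c -> ~ ucycle (induced e A) c.

Definition is_connected (T : finType) (e : rel T) (A : {set T}) : Prop :=
  A != set0 /\ {in A &, forall u v, connect (induced e A) u v}.

Definition is_tree (T : finType) (e : rel T) (A : {set T}) : Prop :=
  is_forest e A /\ is_connected e A.

(* [C] is the vertex set of a connected component of G[A]. *)
Definition is_component (T : finType) (e : rel T) (A C : {set T}) : Prop :=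
  exists2 x, x \in A & C = [set y in A | connect (induced e A) x y].

(* [P] lists the vertices of the path in order: two of them are adjacent
   exactly when they are consecutive.  A vertex of [A] outside [P] is a new
   vertex; its unique neighbour in G[A] is a vertex of [P]. *)
Definition is_caterpillar (T : finType) (e : rel T) (A : {set T}) : Prop :=
  is_tree e A /\
  exists P : seq T,
    [/\ P != [::], uniq P, {subset P <= A},
        {in P &, forall u v, e u v = infix [:: u; v] P || infix [:: v; u] P}
      & {in A, forall v, v \notin P ->
          exists2 u, u \in P & {in A, forall w, e v w = (w == u)}}].

(* Main.v *)
Require Import Defs.
From mathcomp Require Import all_boot all_order all_algebra.
From mathcomp Require Import ring lra.
Import Order.TTheory GRing.Theory Num.Theory.
Local Open Scope ring_scope.

Set Implicit Arguments.
Unset Strict Implicit.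
Unset Printing Implicit Defensive.

(** A caterpillar is a path with pendant vertices, and most of the pendant
    vertices come for free: a vertex of degree 1 in the graph can be put in
    the solution whatever else is chosen, and it contributes exactly its
    weight 2 / (1 + 1) = 1.  Let [L] consist of the degree-1 vertices, but of
    only one vertex of each component that is a single edge
    ([leaf_selection]).  If [F] induces a linear forest, that is, a forest of
    maximum degree at most 2, in the complement of [L], then [L :|: F]
    induces a forest of caterpillars: each component is a path of [F] with
    leaves of [L] attached, or a single vertex of [L]
    ([caterpillar_of_spine]).

    It remains to find a large induced linear forest, and [linear_forest]
    gives one with at least the sum of [weight (deg v)] vertices, where the
    weight is 1 for degree 0, 5/6 for degree 1, and 2 / (d + 1) for degree
    d >= 2.  The weight 5/6 < 1 is what a linear forest can afford for a leaf
    (the star with three leaves weighs exactly 3, and one of its four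
    vertices has to be left out).  It is also large enough for the reduction:
    a vertex outside [L] with a single neighbour outside [L] has degree at
    least 2 in the whole graph, so that at most 2/3 is asked of it, and the
    other vertices have weight 1, or weight 2 / (d + 1) for a degree d that
    has not grown by removing [L] ([weight_bound]).

    For the linear forest, delete a vertex of maximum degree D as long as
    D >= 3.  This loses 2 / (D + 1), and each of its D neighbours gains at
    least 2 / (D (D + 1)), which is where 5/6 is needed once more: going down
    from 2 to 1 or from 1 to 0 must gain 1/6 = 2 / (3 * 4)
    ([weight_drop]).  So the total weight does not decrease.  When D <= 2,
    every component is a path or a cycle; a path is kept whole, and a cycle
    with n >= 3 vertices weighs 2 n / 3 <= n - 1, so it can lose one
    vertex. *)

(** * Degrees, cycles and connectivity in induced subgraphs *)

Definition deg_in (T : finType) (e : rel T) (A : {set T}) (v : T) : nat :=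
  #|[set u in A | e v u]|.

Lemma cycle_neighbours (T : eqType) (r : rel T) (c : seq T) (x : T) :
  ucycle r c -> (2 < size c)%N -> x \in c ->
  exists y z, [/\ y \in c, z \in c, y != z, r x y & r z x].
Proof.
move=> /andP[cyc_c uniq_c] size_c /rot_to[i s rot_c].
have mem_s y : y \in x :: s -> y \in c by rewrite -rot_c mem_rot.
move: cyc_c uniq_c size_c; rewrite -(rot_cycle i) -(rot_uniq i) -(size_rot i) rot_c.
case: s mem_s {rot_c} => [|y s] // mem_s.
case/lastP: s mem_s => [|s z] // mem_s.
rewrite /= !rcons_path last_rcons => /andP[rxy /andP[_ rzx]] /andP[_ /andP[y_s _]] _.
exists y, z; split=> //; first by apply: mem_s; rewrite !inE eqxx orbT.
  by apply: mem_s; rewrite !inE mem_rcons inE eqxx !orbT.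
by apply: contraNneq y_s => ->; rewrite mem_rcons inE eqxx.
Qed.

Lemma induced_connect_sym (T : finType) (e : rel T) (A : {set T}) :
  symmetric e -> connect_sym (induced e A).
Proof.
by move=> e_sym; apply: sym_connect_sym => u w; rewrite /induced /= e_sym andbCA.
Qed.

(** The form in which connectivity is used throughout: a set that no edge of
    the induced subgraph leaves contains everything reachable from it. *)
Lemma connect_induced_closed (T : finType) (e : rel T) (A : {set T})
    (Z : {pred T}) (x y : T) :
  symmetric e -> (forall u w, induced e A u w -> u \in Z -> w \in Z) ->
  connect (induced e A) x y -> x \in Z -> y \in Z.
Proof.
move=> e_sym closedZ xy xZ.
by rewrite -(closed_connect (intro_closed (induced_connect_sym A e_sym) closedZ) xy).
Qed.

Lemma cycle_sub (T : finType) (e : rel T) (A : {set T}) (c : seq T) :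
  cycle (induced e A) c -> {subset c <= A}.
Proof. by move=> cyc x /(next_cycle cyc) /and3P[]. Qed.

Lemma ucycle_induced (T : finType) (e : rel T) (A : {set T}) (c : seq T) :
  {subset c <= A} -> ucycle e c -> ucycle (induced e A) c.
Proof.
move=> sub_c /andP[cyc_c uniq_c]; rewrite /ucycle uniq_c andbT.
apply: (sub_in_cycle (P := mem A)) cyc_c; last exact/allP.
by move=> u w uA wA euw; apply/and3P.
Qed.

Lemma ucycle_of_induced (T : finType) (e : rel T) (A : {set T}) (c : seq T) :
  ucycle (induced e A) c -> ucycle e c.
Proof.
move=> /andP[cyc_c uniq_c]; rewrite /ucycle uniq_c andbT.
by apply: sub_cycle cyc_c => u w /and3P[].
Qed.

Lemma is_forest_sub (T : finType) (e : rel T) (A B : {set T}) :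
  A \subset B -> is_forest e B -> is_forest e A.
Proof.
move=> AB forest_B c size_c cyc_c; apply: (forest_B c size_c).
apply: ucycle_induced (ucycle_of_induced cyc_c) => x xc.
by apply: (subsetP AB); case/andP: cyc_c => /cycle_sub/(_ x xc).
Qed.

(** Cycles have no repeated vertex, hence at most [#|T|] vertices, so the
    search for one is finite and the alternative is decidable. *)
Lemma forest_or_cycle (T : finType) (e : rel T) (A : {set T}) :
  is_forest e A \/ exists2 c : seq T, (2 < size c)%N & ucycle (induced e A) c.
Proof.
case: (boolP [exists n : 'I_#|T|.+1, exists t : n.-tuple T,
                (2 < n)%N && ucycleb (induced e A) t]).
  move=> /existsP[n /existsP[t /andP[n_gt2 cyc_t]]]; right.
  by exists t; rewrite ?size_tuple.
rewrite negb_exists => /forallP no_cycle; left=> c size_c cyc_c.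
have c_le : (size c < #|T|.+1)%N.
  by case/andP: cyc_c => _ /card_uniqP <-; rewrite ltnS max_card.
move: (no_cycle (Ordinal c_le)); rewrite negb_exists => /forallP/(_ (in_tuple c)).
by rewrite /= size_c => /negP[].
Qed.

Lemma deg_in_sub (T : finType) (e : rel T) (A B : {set T}) (v : T) :
  A \subset B -> (deg_in e A v <= deg_in e B v)%N.
Proof.
move=> AB; apply: subset_leq_card; apply/subsetP => u; rewrite !inE.
by case/andP => /(subsetP AB) -> ->.
Qed.

Lemma deg_in_gt2 (T : finType) (e : rel T) (A : {set T}) (v x y z : T) :
  [/\ x \in A, y \in A & z \in A] -> [/\ e v x, e v y & e v z] ->
  uniq [:: x; y; z] -> (2 < deg_in e A v)%N.
Proof.
move=> [xA yA zA] [vx vy vz] uniq_xyz.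
have /= <- := card_uniqP uniq_xyz; apply: subset_leq_card.
by apply/subsetP => u; rewrite !inE => /or3P[]/eqP->; apply/andP.
Qed.

(** A vertex of the cycle already has its two neighbours there, so a graph of
    maximum degree 2 has no room for an edge leaving the cycle: cycles are
    whole components. *)
Lemma cycle_closed (T : finType) (e : rel T) (A : {set T}) (c : seq T) :
  symmetric e -> {in A, forall v, (deg_in e A v <= 2)%N} ->
  (2 < size c)%N -> ucycle (induced e A) c ->
  forall u w, u \in c -> induced e A u w -> w \in c.
Proof.
move=> e_sym deg_le size_c cyc_c u w uc /and3P[uA wA euw].
have [y [z [yc zc yz /and3P[_ yA euy] /and3P[zA _ ezu]]]] :=
  cycle_neighbours cyc_c size_c uc.
apply: contraT => w_c; have := deg_le u uA.
rewrite leqNgt (@deg_in_gt2 _ _ _ _ y z w) //; first by rewrite e_sym in ezu.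
rewrite /= !inE negb_or yz !andbT /=.
by apply/andP; split; apply: contraNneq w_c => <-.
Qed.

(** * Large induced linear forests *)

Definition weight (d : nat) : rat :=
  if d is 0%N then 1 else if d is 1%N then 5 / 6 else 2 / d.+1%:R.

Lemma weight_le1 (d : nat) : weight d <= 1.
Proof.
case: d => [|[|d]]; rewrite /weight; [lra | lra |].
have d0 := ler0n rat d.
by rewrite ler_pdivrMr ?mul1r -!natr1; lra.
Qed.

(** The gain of a neighbour of a deleted vertex of maximum degree [D], whose
    own degree drops from [d.+1] to [d].  For [d >= 2] the gain is
    2 / ((d + 1) (d + 2)), which is smallest for [d.+1 = D]; for [d <= 1] it is
    1/6, the right-hand bound at [D = 3]. *)
Lemma weight_drop (D d : nat) : (3 <= D)%N -> (d < D)%N ->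
  2 / (D%:R * (D%:R + 1)) + weight d.+1 <= weight d.
Proof.
move=> D_ge3 d_lt.
have D3 : 3%:R <= D%:R :> rat by rewrite ler_nat.
have D12 : 12 <= D%:R * (D%:R + 1) :> rat by nra.
have small : 2 / (D%:R * (D%:R + 1)) <= 1 / 6 :> rat.
  by rewrite ler_pdivrMr; lra.
case: d d_lt => [|[|d]] d_lt; rewrite /weight; try lra.
have d3 : 0 < d.+3%:R :> rat by rewrite ltr0n.
have dD : d.+3%:R <= D%:R :> rat by rewrite ler_nat.
have -> : 2 / d.+3%:R = 2 / (d.+3%:R * (d.+3%:R + 1)) + 2 / d.+4%:R :> rat.
  by rewrite -[d.+4%:R]natr1; field; apply/andP; split; lra.
have d4 : 0 < d.+3%:R * (d.+3%:R + 1) :> rat by nra.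
have D4 : 0 < D%:R * (D%:R + 1) :> rat by lra.
by rewrite lerD2r ler_pM2l // lef_pV2 ?posrE //; nra.
Qed.

Lemma max_deg (T : finType) (e : rel T) (A : {set T}) :
  {in A, forall v, (deg_in e A v <= 2)%N} \/
  exists2 v, v \in A & (2 < deg_in e A v)%N /\
    {in A, forall u, (deg_in e A u <= deg_in e A v)%N}.
Proof.
case: (boolP [forall v in A, (deg_in e A v <= 2)%N]) => [/forall_inP|]; first by left.
rewrite negb_forall_in => /exists_inP[v0 v0A deg_v0]; right.
case: (arg_maxnP (deg_in e A) v0A) => v vA max_v; exists v => //.
by split=> //; rewrite (leq_trans _ (max_v v0 v0A)) // ltnNge.
Qed.

(** Deleting a vertex of degree at least 3 that has maximum degree does not
    lower the total weight.  When no such vertex is left, a cycle is a whole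
    component and can be settled on its own: all its vertices but one are
    kept, and the induction goes on outside it. *)
Lemma linear_forest (T : finType) (e : rel T) (A : {set T}) :
  symmetric e -> irreflexive e ->
  exists S : {set T},
    [/\ S \subset A, is_forest e S, {in S, forall v, (deg_in e S v <= 2)%N}
      & \sum_(v in A) weight (deg_in e A v) <= #|S|%:R].
Proof.
move=> e_sym e_irr; have [n] := ubnP #|A|; elim: n A => // n IHn A /ltnSE card_A.
have [deg_le|[v vA [deg_v max_v]]] := max_deg e A.
  have [forest_A|[c size_c cyc_c]] := forest_or_cycle e A.
    exists A; split=> //; rewrite -sum1_card natr_sum.
    by apply: ler_sum => v _; apply: weight_le1.
  have [cyc uniq_c] := andP cyc_c.
  have cA := cycle_sub cyc.
  have closed_c := cycle_closed e_sym deg_le size_c cyc_c.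
  case: c size_c cyc_c cyc uniq_c cA closed_c => // x c size_c cyc_c cyc uniq_c cA closed_c.
  set K := [set y in x :: c]; set A' := A :\: K.
  have KA : K \subset A by apply/subsetP => y; rewrite inE => /cA.
  have card_K : #|K| = (size c).+1.
    by rewrite /K cardsE (card_uniqP uniq_c).
  have [|S [SA' forest_S deg_S sum_S]] := IHn A'.
    have := subset_leq_card KA; rewrite card_K => card_KA.
    apply: leq_trans card_A; rewrite cardsD (setIidPr KA) card_K.
    by rewrite ltn_subLR // addSn ltnS leq_addl.
  have A'A : A' \subset A by apply: subsetDl.
  have SA := subset_trans SA' A'A.
  exists (S :|: (K :\ x)).
  have US : S :|: (K :\ x) \subset A by rewrite subUset SA (subset_trans _ KA) ?subD1set.
  split=> //.
  - move=> c' size_c' cyc_c'.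
    have [cyc' uniq_c'] := andP cyc_c'.
    have c'U := cycle_sub cyc'.
    have c'A : ucycle (induced e A) c'.
      by apply: ucycle_induced (ucycle_of_induced cyc_c') => y /c'U; apply/subsetP.
    (* A cycle c' meeting c would contain the whole component c, hence x,
       which has been dropped; so c' avoids c and lies in S. *)
    have [/hasP[y yc' yc]|disj] := boolP (has (mem (x :: c)) c').
      have closed_c' := cycle_closed e_sym deg_le size_c' c'A.
      have xc' : x \in c'.
        apply: connect_induced_closed (e_sym) _ (connect_cycle cyc yc _) yc'.
          by move=> u w euw uc'; apply: closed_c' euw.
        exact: mem_head.
      have x_notS : x \notin S.
        by apply/negP => /(subsetP SA'); rewrite !inE eqxx.
      by have := c'U x xc'; rewrite !inE eqxx (negPf x_notS).
    apply: (forest_S c' size_c'); apply: ucycle_induced (ucycle_of_induced cyc_c') => y yc'.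
    have := c'U y yc'; rewrite in_setU => /orP[//|].
    rewrite in_setD1 in_set => /andP[_ yc].
    by case/hasP: disj; exists y.
  - by move=> v vS; apply: leq_trans (deg_le v (subsetP US v vS)); apply: deg_in_sub.
  have disj : S :&: (K :\ x) = set0.
    apply/setP => y; rewrite in_setI in_setD1 in_set0; apply/negP => /and3P[].
    by move=> /(subsetP SA'); rewrite in_setD => /andP[/negP].
  have xK : x \in K by rewrite !inE eqxx.
  have card_U : #|S :|: (K :\ x)| = (#|S| + size c)%N.
    rewrite cardsU disj cards0 subn0; congr addn.
    by move: card_K; rewrite (cardsD1 x) xK add1n => -[].
  rewrite card_U natrD (big_setID K) /= (setIidPr KA) addrC lerD //.
    (* No edge joins the cycle to A', so degrees in A' are unaffected. *)
    rewrite (eq_bigr (fun v => weight (deg_in e A' v))) // => v.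
    rewrite !inE => /andP[v_c vA]; congr weight; apply: eq_card => u.
    rewrite !inE; case evu: (e v u); rewrite ?andbF // !andbT.
    case uA: (u \in A); rewrite ?andbF ?andbT //.
    apply/esym/negP => uc; case/negP: v_c.
    apply: (closed_c u v uc); apply/and3P; split=> //; last by rewrite e_sym.
  have -> : \sum_(v in K) weight (deg_in e A v) = \sum_(v in K) (2 / 3).
    apply: eq_bigr => v vK; have vA := subsetP KA v vK.
    have vc : v \in x :: c by rewrite inE in vK.
    suff -> : deg_in e A v = 2%N by [].
    apply/eqP; rewrite eqn_leq deg_le //=.
    have [y [z [yc zc yz /and3P[_ yA evy] /and3P[zA _ ezv]]]] :=
      cycle_neighbours cyc_c size_c vc.
    rewrite -(_ : #|[set y; z]| = 2%N); last by rewrite cards2 yz.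
    apply: subset_leq_card; apply/subsetP => u; rewrite !inE.
    by case/orP => /eqP->; rewrite ?yA ?zA //= e_sym.
  rewrite sumr_const card_K -mulr_natl -natr1.
  have : 2 <= (size c)%:R :> rat by rewrite ler_nat.
  by lra.
have [|S [SA' forest_S deg_S sum_S]] := IHn (A :\ v).
  by apply: leq_trans card_A; rewrite [X in (_ < X)%N](cardsD1 v) vA.
exists S; split=> //; first exact: subset_trans SA' (subD1set _ _).
apply: le_trans sum_S.
set D := deg_in e A v; pose g : rat := 2 / (D%:R * (D%:R + 1)).
have D3 : 3 <= D%:R :> rat by rewrite ler_nat.
(* g is the gain per neighbour of v; D of them make up the weight of v. *)
have gain u : u \in A :\ v ->
    weight (deg_in e A u) + (if e v u then g else 0) <= weight (deg_in e (A :\ v) u).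
  rewrite !inE => /andP[uv uA].
  have := max_v u uA; rewrite -/D /deg_in (cardsD1 v) inE vA /= e_sym.
  have -> : [set w in A | e u w] :\ v = [set w in A :\ v | e u w].
    by apply/setP => w; rewrite !inE andbA.
  case: (e v u); rewrite ?add0n ?addr0 // add1n addrC => deg_u.
  exact: weight_drop.
rewrite (big_setD1 v) //=; apply: le_trans (ler_sum _ gain).
rewrite big_split /= addrC lerD2l -big_mkcondr /= sumr_const.
have -> : #|[pred i in A :\ v | e v i]| = D.
  apply: eq_card => u; rewrite !inE.
  by have [->|] := eqVneq u v; rewrite ?e_irr ?andbF.
have -> : weight D = 2 / (D%:R + 1).
  by rewrite natr1; case: (D) (deg_v : (2 < D)%N) => [|[|d]].
suff -> : 2 / (D%:R + 1) = g *+ D by [].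
by rewrite -mulr_natl /g; field; apply/andP; split; lra.
Qed.

(** * The spine of a caterpillar *)

Lemma longest_path (T : finType) (e : rel T) (B : {set T}) (x : T) :
  x \in B ->
  exists P : seq T,
    [/\ P != [::], sorted e P, uniq P, {subset P <= B}
      & forall Q, sorted e Q -> uniq Q -> {subset Q <= B} ->
          (size Q <= size P)%N].
Proof.
move=> xB.
pose path_size n := [exists t : n.-tuple T, [&& sorted e t, uniq t & all (mem B) t]].
have path_sizeP Q : sorted e Q -> uniq Q -> {subset Q <= B} -> path_size (size Q).
  by move=> ? ? ?; apply/existsP; exists (in_tuple Q); apply/and3P; split=> //; apply/allP.
have size1 : exists n, path_size n.
  by exists 1%N; apply: (path_sizeP [:: x]) => // y; rewrite inE => /eqP->.
have size_le n : path_size n -> (n <= #|T|)%N.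
  case/existsP => t /and3P[_ uniq_t _].
  by rewrite -(size_tuple t) -(card_uniqP uniq_t) max_card.
case: (ex_maxnP size1 size_le) => n /existsP[t /and3P[sorted_t uniq_t /allP t_B]] max_n.
have max_t Q : sorted e Q -> uniq Q -> {subset Q <= B} -> (size Q <= size t)%N.
  by rewrite size_tuple => *; apply: max_n; apply: path_sizeP.
exists t; split=> //; apply/negP => /eqP t0.
have := max_t [:: x] isT isT; rewrite t0 ltn0 => bad.
by apply: notF; apply: bad => y; rewrite inE => /eqP->.
Qed.

(** An inner vertex of the path already has two neighbours on it, and an end
    with a neighbour outside would allow a longer path.  So the vertices of a
    longest path in a graph of maximum degree 2 form a whole component. *)
Lemma longest_path_closed (T : finType) (e : rel T) (B : {set T}) (P : seq T) :
  symmetric e -> {in B, forall v, (deg_in e B v <= 2)%N} ->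
  sorted e P -> uniq P -> {subset P <= B} ->
  (forall Q, sorted e Q -> uniq Q -> {subset Q <= B} -> (size Q <= size P)%N) ->
  forall u w, u \in P -> w \in B -> e u w -> w \in P.
Proof.
move=> e_sym deg_le sorted_P uniq_P PB max_P u w uP wB euw; apply: contraT => w_P.
have longer Q : sorted e Q -> perm_eq Q (w :: P) -> false.
  move=> sorted_Q perm_Q; have := max_P Q sorted_Q.
  rewrite (perm_uniq perm_Q) /= w_P uniq_P (perm_size perm_Q) ltnn; apply=> // y.
  by rewrite (perm_mem perm_Q) inE => /predU1P[->|/PB].
case/splitPr: uP sorted_P uniq_P PB w_P longer {max_P} => p1 p2.
case: p1 => [|a p1] sorted_P uniq_P PB w_P longer.
  by apply: (longer (w :: u :: p2)) => //=; rewrite e_sym euw.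
case: p2 sorted_P uniq_P PB w_P longer => [|z p2] sorted_P uniq_P PB w_P longer.
  apply: (longer (rcons (a :: p1 ++ [:: u]) w)); last by rewrite perm_rcons.
  by rewrite /= rcons_path last_cat /= euw andbT.
have uB : u \in B by apply: PB; rewrite mem_cat mem_head orbT.
have zB : z \in B by apply: PB; rewrite mem_cat !inE eqxx !orbT.
have yB : last a p1 \in B by apply: PB; rewrite mem_cat mem_last.
have := deg_le u uB; rewrite leqNgt => /negP[].
move: sorted_P; rewrite /= cat_path /= => /and4P[_ eyu euz _].
apply: (@deg_in_gt2 _ _ _ _ (last a p1) z w) => //; first by rewrite e_sym in eyu.
rewrite /= !inE negb_or andbT; apply/andP; split; first apply/andP; first split.
- move: uniq_P; rewrite cat_uniq => /and3P[_ /hasPn disj _].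
  by apply: contraTneq (mem_last a p1) => ->; apply: disj; rewrite !inE eqxx orbT.
- by apply: contraNneq w_P => <-; rewrite mem_cat mem_last.
- by apply: contraNneq w_P => <-; rewrite mem_cat !inE eqxx !orbT.
Qed.

(** Otherwise the edge [e u v] would close the part of the path from [u] to
    [v] into a cycle. *)
Lemma forest_chord (T : finType) (e : rel T) (A : {set T}) (p1 p2 : seq T) (u v : T) :
  symmetric e -> is_forest e A ->
  sorted e (p1 ++ u :: p2) -> uniq (p1 ++ u :: p2) ->
  {subset p1 ++ u :: p2 <= A} -> v \in p2 -> e u v ->
  infix [:: u; v] (p1 ++ u :: p2).
Proof.
move=> e_sym forest_A sorted_P uniq_P PA vp2 euv.
case/splitPr: vp2 sorted_P uniq_P PA => q r; case: q => [|w q] sorted_P uniq_P PA.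
  by apply/infixP; exists p1, r.
set c := u :: rcons (w :: q) v; exfalso.
have eq_P : p1 ++ u :: (w :: q) ++ v :: r = p1 ++ c ++ r by rewrite /c /= cat_rcons.
apply: (forest_A c); first by rewrite /= size_rcons.
apply: ucycle_induced => [y yc|].
  by apply: PA; rewrite eq_P !mem_cat yc orbT.
apply/andP; split.
  rewrite /c (cycle_path u) /= last_rcons e_sym euv /=.
  have := cat_sorted2 sorted_P => -[_].
  by rewrite /= -cat_rcons cat_path => /andP[-> /andP[]].
by move: uniq_P; rewrite eq_P !cat_uniq => /and3P[_ _ /andP[]].
Qed.

(** A longest path in [B] together with the vertices attached to it is closed
    under adjacency in the connected graph on [A], so it is all of [A], and
    the path runs through all of [B].  It has no chord because [A] induces a
    forest. *)
Lemma caterpillar_of_spine (T : finType) (e : rel T) (A B : {set T}) :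
  symmetric e -> irreflexive e -> is_tree e A -> B \subset A -> B != set0 ->
  {in B, forall v, (deg_in e B v <= 2)%N} ->
  {in A, forall a, a \notin B ->
    exists2 u, u \in B & {in A, forall w, e a w = (w == u)}} ->
  is_caterpillar e A.
Proof.
move=> e_sym e_irr tree_A BA /set0Pn[b bB] deg_le hang; split=> //.
have [forest_A [_ conn_A]] := tree_A.
have [P [P_n0 sorted_P uniq_P PB max_P]] := longest_path e bB.
have closed_P := longest_path_closed e_sym deg_le sorted_P uniq_P PB max_P.
have PA : {subset P <= A} by move=> y /PB; apply/subsetP.
have [x xP] : exists x, x \in P by case: (P) P_n0 => // x p; exists x; apply: mem_head.
pose Z := [pred a | (a \in P) || (a \notin B) && has (e a) P].
have AZ a : a \in A -> a \in Z.
  move=> aA; have xZ : x \in Z by rewrite inE xP.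
  apply: connect_induced_closed (e_sym) _ (conn_A x a (PA x xP) aA) xZ => u w.
  move=> /and3P[uA wA euw]; rewrite !inE => /orP[uP|/andP[u_B /hasP[p pP eup]]].
    case: (boolP (w \in B)) => wB; first by rewrite (closed_P u w uP wB euw).
    by apply/orP; right; apply/hasP; exists u; rewrite // e_sym.
  have [u' _ nbr_u] := hang u uA u_B.
  move: eup euw; rewrite (nbr_u p (PA p pP)) (nbr_u w wA) => /eqP<- /eqP->.
  by rewrite pP.
have BP : {subset B <= P}.
  by move=> a aB; have := AZ a (subsetP BA a aB); rewrite inE aB orbF.
exists P; split=> //.
- move=> u v uP vP /=; apply/idP/idP => [euv|].
    case/splitPr: uP sorted_P uniq_P PA vP {max_P closed_P PB P_n0 xP Z AZ BP}.
    move=> p1 p2 sorted_P uniq_P PA vP.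
    move: (vP); rewrite mem_cat inE => /or3P[vp1|/eqP uv|vp2].
    + case/splitPr: vp1 sorted_P uniq_P PA vP => q r.
      rewrite -catA /= => sorted_P uniq_P PA vP; apply/orP; right.
      apply: forest_chord sorted_P uniq_P PA _ _ => //; last by rewrite e_sym.
      by rewrite mem_cat mem_head orbT.
    + by rewrite uv e_irr in euv.
    + by apply/orP; left; apply: forest_chord sorted_P uniq_P PA _ _.
  have step y z : infix [:: y; z] P -> e y z.
    case/infixP => p1 [p2 eq_P]; move: sorted_P; rewrite eq_P.
    by case/cat_sorted2 => _ /andP[].
  by case/orP => /step //; rewrite e_sym.
- move=> v vA v_P; have v_B : v \notin B by apply: contra v_P => /BP.
  by have [u /BP uP nbr_v] := hang v vA v_B; exists u.
Qed.

(** * Components and leaves *)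

(** A walk from a vertex of the component never leaves the component. *)
Lemma component_connected (T : finType) (e : rel T) (S C : {set T}) :
  symmetric e -> is_component e S C -> is_connected e C.
Proof.
move=> e_sym [x xS defC].
have xC : x \in C by rewrite defC inE xS connect0.
split; first by apply/set0Pn; exists x.
have conn_x y : y \in C -> connect (induced e C) x y.
  rewrite {1}defC inE => /andP[_ xy].
  pose Z := [pred y | (y \in C) && connect (induced e C) x y].
  suff /andP[] : y \in Z by [].
  apply: connect_induced_closed (e_sym) _ xy _; last by rewrite inE xC connect0.
  move=> u w uw; rewrite !inE => /andP[uC xu].
  have wC : w \in C.
    move: uC; rewrite defC !inE => /andP[uS Sxu].
    by case/and3P: (uw) => _ -> _; rewrite (connect_trans Sxu) ?connect1.
  rewrite wC (connect_trans xu) // connect1 //.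
  by case/and3P: uw => _ _ euw; apply/and3P.
move=> u v uC vC; apply: connect_trans (conn_x v vC).
by rewrite (induced_connect_sym C e_sym) conn_x.
Qed.

(** The degree-1 vertices, where the two ends of an isolated edge are told apart
    by [enum_rank] so that exactly one of them is selected.  The second property
    says that the other end, which is not selected, becomes isolated when the
    selected vertices are removed. *)
Lemma leaf_selection (T : finType) (e : rel T) :
  symmetric e -> irreflexive e ->
  exists L : {set T},
    {in L, forall a, exists2 u, u \notin L & forall w, e a w = (w == u)} /\
    (forall v, v \notin L -> degree e v = 1%N -> deg_in e (~: L) v = 0%N).
Proof.
move=> e_sym e_irr.
pose L := [set v | (degree e v == 1%N) &&
  [forall u, e v u ==> (degree e u == 1%N) ==> (enum_rank u < enum_rank v)%N]].
have one_nbr v : degree e v = 1%N -> exists u, forall w, e v w = (w == u).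
  move/eqP/cards1P => [u /setP nbr_v]; exists u => w.
  by have := nbr_v w; rewrite !inE.
exists L; split.
  move=> a; rewrite inE => /andP[/eqP deg_a /forallP lt_a].
  have [u nbr_a] := one_nbr a deg_a; exists u => //.
  have eau : e a u by rewrite nbr_a.
  apply/negP; rewrite inE => /andP[deg_u /forallP/(_ a)].
  have := lt_a u; rewrite eau deg_u e_sym eau deg_a /= => ltua ltau.
  by have := ltn_trans ltua ltau; rewrite ltnn.
move=> v v_L deg_v; have [u nbr_v] := one_nbr v deg_v.
have evu : e v u by rewrite nbr_v.
suff uL : u \in L.
  apply/eqP; rewrite cards_eq0; apply/eqP/setP => w.
  by rewrite in_set nbr_v in_setC in_set0; case: eqP => [->|]; rewrite ?uL ?andbF.
move: v_L; rewrite inE deg_v eqxx negb_forall => /existsP[u'].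
rewrite nbr_v !negb_imply => /and3P[/eqP-> deg_u le_uv].
rewrite inE deg_u /=; apply/forallP => w; apply/implyP => euw; apply/implyP => _.
have [u2 nbr_u] := one_nbr u (eqP deg_u).
move: euw; have := evu; rewrite e_sym !nbr_u => /eqP<- /eqP->.
rewrite ltn_neqAle leqNgt le_uv andbT.
by apply: contraTneq evu => /val_inj/enum_rank_inj->; rewrite e_irr.
Qed.

(** Here [d] is the degree of a vertex in the graph and [d'] its degree after
    removing the selected leaves.  If [d' = 1] then [d >= 2], and 2/3 <= 5/6. *)
Lemma weight_bound (d d' : nat) :
  (0 < d)%N -> (d' <= d)%N -> (d = 1%N -> d' = 0%N) ->
  2 / (d%:R + 1) <= weight d'.
Proof.
rewrite natr1; case: d => [//|[|d]] _ d'_le d1; first by rewrite (d1 erefl) /weight; lra.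
have d3 : 3 <= d.+3%:R :> rat by rewrite ler_nat.
have d_bound : 2 / d.+3%:R <= 2 / 3 :> rat by rewrite ler_pM2l // lef_pV2 ?posrE //; lra.
case: d' d'_le {d1} => [|[|d']] d'_le; rewrite /weight.
- by apply: le_trans d_bound _; lra.
- by apply: le_trans d_bound _; lra.
by rewrite ler_pM2l // lef_pV2 ?posrE ?ltr0n // ler_nat.
Qed.

Theorem corollary5 (T : finType) (e : rel T)
    (e_sym : symmetric e) (e_irr : irreflexive e)
    (no_isolated : forall v : T, (0 < degree e v)%N) :
  exists S : {set T},
    [/\ is_forest e S,
        (\sum_(v : T) 2%:R / ((degree e v)%:R + 1) : rat) <= #|S|%:R
      & forall C : {set T}, is_component e S C -> is_caterpillar e C].
Proof.
have [L [nbr_L deg_L]] := leaf_selection e_sym e_irr.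
have [F [FH forest_F deg_F sum_F]] := linear_forest (~: L) e_sym e_irr.
have forest_S : is_forest e (L :|: F).
  move=> c size_c cyc_c; have [cyc _] := andP cyc_c.
  (* A vertex of L has one neighbour, a vertex of a cycle two. *)
  have [/hasP[a ac aL]|no_leaf] := boolP (has (mem L) c).
    have [u _ nbr_a] := nbr_L a aL.
    have [y [z [_ _ yz /and3P[_ _ ay] /and3P[_ _ za]]]] := cycle_neighbours cyc_c size_c ac.
    by move: ay za yz; rewrite [e z a]e_sym !nbr_a => /eqP-> /eqP->; rewrite eqxx.
  apply: (forest_F c size_c); apply: ucycle_induced (ucycle_of_induced cyc_c) => y yc.
  have := cycle_sub cyc yc; rewrite in_setU => /orP[yL|//].
  by case/hasP: no_leaf; exists y.
exists (L :|: F); split=> //.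
  have disj : L :&: F = set0.
    by apply: disjoint_setI0; rewrite disjoint_sym disjoints_subset.
  rewrite cardsU disj cards0 subn0 natrD (bigID (mem L)) /= lerD //.
    rewrite -sum1_card natr_sum; apply: ler_sum => a aL.
    have [u _ nbr_a] := nbr_L a aL.
    have -> : degree e a = 1%N.
      by rewrite /degree -(cards1 u); apply: eq_card => w; rewrite !inE nbr_a.
    by rewrite natr1; lra.
  apply: le_trans sum_F; rewrite (eq_bigl (fun v => v \in ~: L)) => [|v]; last by rewrite in_setC.
  apply: ler_sum => v; rewrite in_setC => v_L; apply: weight_bound (deg_L v v_L) => //.
  by apply: subset_leq_card; apply/subsetP => u; rewrite !inE => /andP[].
move=> C compC; have [x xS defC] := compC.
have CS : C \subset L :|: F by apply/subsetP => y; rewrite defC inE => /andP[].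
have tree_C : is_tree e C.
  by split; [apply: is_forest_sub forest_S | apply: component_connected compC].
(* A component avoiding F lies in L, so its degrees are at most 1 and it
   serves as its own spine. *)
have [CF0|CF_n0] := eqVneq (C :&: F) set0.
  apply: (@caterpillar_of_spine _ _ _ C) => //; first by have [_ []] := tree_C.
    move=> a aC; have aL : a \in L.
      have := subsetP CS a aC; rewrite in_setU => /orP[//|aF].
      by have := in_set0 a; rewrite -CF0 in_setI aC aF.
    have [u _ nbr_a] := nbr_L a aL.
    apply: leq_trans (_ : #|[set u]| <= _)%N; last by rewrite cards1.
    by apply: subset_leq_card; apply/subsetP => w; rewrite !inE nbr_a => /andP[].
  by move=> a ->.
apply: (@caterpillar_of_spine _ _ _ (C :&: F)) => //; first exact: subsetIl.
  move=> v; rewrite in_setI => /andP[_ vF]; apply: leq_trans (deg_F v vF).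
  by apply: deg_in_sub; apply: subsetIr.
move=> a aC; rewrite in_setI aC /= => a_F.
have aL : a \in L by have := subsetP CS a aC; rewrite in_setU (negPf a_F) orbF.
have [u u_L nbr_a] := nbr_L a aL; exists u; last by move=> w _.
have [_ [_ conn_C]] := tree_C.
have /set0Pn[b] := CF_n0; rewrite in_setI => /andP[bC bF].
have uC : u \in C.
  (* Otherwise a would be isolated in C, and C = {a} would avoid F. *)
  apply: contraT => u_C.
  have /eqP ba : b \in pred1 a.
    apply: connect_induced_closed (e_sym) _ (conn_C a b aC bC) _; last by rewrite inE.
    move=> y w /and3P[_ wC eyw]; rewrite !inE => /eqP ya.
    by move: eyw wC; rewrite ya nbr_a => /eqP->; rewrite (negPf u_C).
  by rewrite -ba bF in a_F.
rewrite in_setI uC /=.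
by have := subsetP CS u uC; rewrite in_setU (negPf u_L).
Qed.
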